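(* Let $d\in\{1,2,3\}$ and let $K\subset M^{m\times n}$ be a $d$-dimensional linear subspace without Rank-$1$ connections. Let $M_1,\dots,M_{q_0}$ be all the $2\times2$ minors of $m\times n$ matrices. Then there exists $\beta\in\mathbb{R}^{q_0}\setminus\{0\}$ such that $\sum_{k=1}^{q_0}\beta_kM_k(X)\ge0$ for all $X\in K$ and $\sum_{k=1}^{q_0}\beta_kM_k\not\equiv0$ on $K$.
   Context: A set has Rank-$1$ connections if it contains $A\ne B$ with $\mathrm{Rank}(A-B)=1$. *)

(* Defs.v *)
From HB Require Import structures.
From mathcomp Require Import all_boot all_order all_algebra.
From mathcomp Require Import reals.
Set Implicit Arguments. Unset Strict Implicit. Unset Printing Implicit Defensive.
Import Order.TTheory GRing.Theory Num.Theory.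
Local Open Scope ring_scope.

Definition minor_idx (m n : nat) : finType :=
  {p : ('I_m * 'I_m) * ('I_n * 'I_n) | (p.1.1 < p.1.2)%N && (p.2.1 < p.2.2)%N}.

Definition minor2 (R : pzRingType) (m n : nat) (k : minor_idx m n)
  (X : 'M[R]_(m, n)) : R :=
  let: (i1, i2, (j1, j2)) := val k in
  X i1 j1 * X i2 j2 - X i1 j2 * X i2 j1.

Definition has_rank1_connections (F : fieldType) (m n : nat)
  (K : {vspace 'M[F]_(m, n)}) : Prop :=
  exists A B, A \in K /\ B \in K /\ A != B /\ \rank (A - B) = 1%N.

(* Main.v *)
Require Import Defs.
From HB Require Import structures.
From mathcomp Require Import all_boot all_order all_algebra.
From mathcomp Require Import reals.
From mathcomp Require polyrcf.
From mathcomp Require Import ring lra zify.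
Import Order.TTheory GRing.Theory Num.Theory.
Local Open Scope ring_scope.
Set Implicit Arguments. Unset Strict Implicit. Unset Printing Implicit Defensive.

(** Fixing a basis of [K], view [K] as a bilinear map [w] into [R^d], where
[w u a] is the linear form [X |-> u X a^T] on [K].  Each 2x2 block determinant
[w(u,a) w(v,b) - w(u,b) w(v,a)] is a combination of 2x2 minors, so it suffices
to find a sum of such determinants that is nonnegative and nonzero.

Suppose [w u a = 0], while [w u] and [w (-) a] are not identically zero.  If
their images share a form [l <> 0], then [l^2] is such a determinant.  Otherwise,
as [d <= 3], one of the images is a line, spanned by [e] say.  Then either [e^2]
is a sum of block determinants, or [K] contains a rank-one matrix.

Such a pair exists for nondegenerate [w] unless the matrices are 2x2: two
maps from [R^3] to [R^d] have a singular combination, because a real 3x3 matrix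
has an eigenvalue.  In the 2x2 case the determinant has no zero on [K] except
the origin, so it is definite. *)

(** * Linear functions as matrices, and the pairing of rows with columns *)

Lemma linear_mulmxE (F : fieldType) (n d : nat) (f : 'rV[F]_n -> 'rV[F]_d) :
  linear f -> forall a, a *m (\matrix_i f 'e_i) = f a.
Proof.
move=> fl a; pose g : {linear _ -> _} :=
  HB.pack f (GRing.isLinear.Build F _ _ _ f fl).
rewrite mulmx_sum_row [in RHS](row_sum_delta a) -[f _]/(g _) linear_sum.
by apply: eq_bigr => i _; rewrite linearZ rowK.
Qed.

Section LinearProp.
Variables (F : fieldType) (n d : nat) (f : 'rV[F]_n -> 'rV[F]_d).
Hypothesis fl : linear f.

Lemma linpD x y : f (x + y) = f x + f y.
Proof. by rewrite -!(linear_mulmxE fl) mulmxDl. Qed.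
Lemma linpB x y : f (x - y) = f x - f y.
Proof. by rewrite -!(linear_mulmxE fl) mulmxBl. Qed.
Lemma linpZ k x : f (k *: x) = k *: f x.
Proof. by rewrite -!(linear_mulmxE fl) scalemxAl. Qed.
End LinearProp.

Section Pairing.
Variables (F : fieldType) (d : nat).
Implicit Types (y : 'rV[F]_d) (x : 'cV[F]_d).

Definition pairing y x := (y *m x) 0 0.

Lemma pairing0l x : pairing 0 x = 0.
Proof. by rewrite /pairing mul0mx mxE. Qed.
Lemma pairing0r y : pairing y 0 = 0.
Proof. by rewrite /pairing mulmx0 mxE. Qed.
Lemma pairingBl y z x : pairing (y - z) x = pairing y x - pairing z x.
Proof. by rewrite /pairing mulmxBl !mxE. Qed.
Lemma pairingZl k y x : pairing (k *: y) x = k * pairing y x.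
Proof. by rewrite /pairing -scalemxAl mxE. Qed.
Lemma pairingDr y x z : pairing y (x + z) = pairing y x + pairing y z.
Proof. by rewrite /pairing mulmxDr mxE. Qed.
Lemma pairingZr k y x : pairing y (k *: x) = k * pairing y x.
Proof. by rewrite /pairing -scalemxAr mxE. Qed.
Lemma pairing_suml (I : Type) (r : seq I) (y : I -> 'rV[F]_d) x :
  pairing (\sum_(i <- r) y i) x = \sum_(i <- r) pairing (y i) x.
Proof. by rewrite /pairing mulmx_suml summxE. Qed.
Lemma pairing_col p (A : 'M_(d, p)) y j : pairing y (col j A) = (y *m A) 0 j.
Proof. by rewrite /pairing colE mulmxA -colE mxE. Qed.
End Pairing.

Lemma pairing_neq0 (F : fieldType) (d : nat) (y : 'rV[F]_d) :
  y != 0 -> exists x, pairing y x != 0.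
Proof.
case/rV0Pn=> i yi; exists (delta_mx i 0).
by rewrite /pairing -colE mxE.
Qed.

(** * Bilinear maps, rank-one elements and block determinants *)

Section BilinearMaps.
Variables (F : rcfType) (d : nat).

Definition bilin m n (w : 'rV[F]_m -> 'rV[F]_n -> 'rV[F]_d) :=
  (forall u, linear (w u)) /\ (forall a, linear (w^~ a)).

(** Here [x] holds the coordinates of a matrix, and the factorisation says that this matrix has rank
    at most 1. Thus nonzero coordinates never give the zero matrix either. As plain functions, [f]
    and [g] compose freely with changes of variables. *)
Definition no_rank1 m n (w : 'rV[F]_m -> 'rV[F]_n -> 'rV[F]_d) :=
  forall x (f : 'rV_m -> F) (g : 'rV_n -> F),
    (forall u a, pairing (w u a) x = f u * g a) -> x = 0.

Definition block_det m n (w : 'rV[F]_m -> 'rV[F]_n -> 'rV[F]_d)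
    (t : 'rV_m * 'rV_m * ('rV_n * 'rV_n)) x :=
  pairing (w t.1.1 t.2.1) x * pairing (w t.1.2 t.2.2) x
  - pairing (w t.1.1 t.2.2) x * pairing (w t.1.2 t.2.1) x.

(** The sum carries no coefficients because a scalar can be absorbed into one of the four vectors of
    a block. *)
Definition psd_block_sum m n (w : 'rV[F]_m -> 'rV[F]_n -> 'rV[F]_d) :=
  exists s, (forall x, 0 <= \sum_(t <- s) block_det w t x) /\
            exists x, \sum_(t <- s) block_det w t x != 0.

Lemma bilin_swap m n (w : 'rV_m -> 'rV_n -> 'rV_d) :
  bilin w -> bilin (fun a u => w u a).
Proof. by case. Qed.

Lemma no_rank1_swap m n (w : 'rV_m -> 'rV_n -> 'rV_d) :
  no_rank1 w -> no_rank1 (fun a u => w u a).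
Proof. by move=> nw x f g fg; apply: (nw x g f) => u a; rewrite fg mulrC. Qed.

Lemma psd_block_sum_swap m n (w : 'rV_m -> 'rV_n -> 'rV_d) :
  psd_block_sum (fun a u => w u a) -> psd_block_sum w.
Proof.
case=> s [s0 [x sx]]; exists [seq (t.2, t.1) | t <- s].
have E z : \sum_(t <- [seq (t.2, t.1) | t <- s]) block_det w t z =
  \sum_(t <- s) block_det (fun a u => w u a) t z.
  by rewrite big_map; apply: eq_bigr => t _; rewrite /block_det /=; ring.
by split=> [z|]; [rewrite E|exists x; rewrite E].
Qed.

Lemma psd_block_sum1 m n (w : 'rV_m -> 'rV_n -> 'rV_d) t :
  (forall x, 0 <= block_det w t x) -> (exists x, block_det w t x != 0) ->
  psd_block_sum w.
Proof.
move=> t0 [x tx]; exists [:: t].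
by split=> [z|]; [|exists x]; rewrite big_seq1.
Qed.

Section BilinLeft.
Variables (m n : nat) (w : 'rV[F]_m -> 'rV[F]_n -> 'rV[F]_d).
Hypothesis bw : bilin w.

Lemma bilinBl u v a : w (u - v) a = w u a - w v a.
Proof. exact: linpB (bw.2 a) u v. Qed.
Lemma bilinZl k u a : w (k *: u) a = k *: w u a.
Proof. exact: linpZ (bw.2 a) k u. Qed.
End BilinLeft.

Lemma pairing_bilin m n (w : 'rV_m -> 'rV_n -> 'rV_d) u a x : bilin w ->
  pairing (w u a) x
  = \sum_i \sum_j u 0 i * a 0 j * pairing (w 'e_i 'e_j) x.
Proof.
move=> [lr ll]; rewrite -(linear_mulmxE (ll a)) mulmx_sum_row pairing_suml.
apply: eq_bigr => i _; rewrite pairingZl rowK -(linear_mulmxE (lr 'e_i)).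
rewrite mulmx_sum_row pairing_suml mulr_sumr; apply: eq_bigr => j _.
by rewrite pairingZl rowK mulrA.
Qed.

Lemma no_rank1_basis m n (w : 'rV_m -> 'rV_n -> 'rV_d) x f g :
  bilin w -> no_rank1 w ->
  (forall i j, pairing (w 'e_i 'e_j) x = f i * g j) -> x = 0.
Proof.
move=> bw nw fg.
apply: (nw x (fun u => \sum_i u 0 i * f i) (fun a => \sum_j a 0 j * g j)) => u a.
rewrite pairing_bilin // mulr_suml; apply: eq_bigr => i _.
by rewrite mulr_sumr; apply: eq_bigr => j _; rewrite fg; ring.
Qed.

(** * Building a square from a zero of the bilinear map *)

(* If [e] lies in the span of the [w v c] with [lam c = 0], then [e^2] is a
   block sum; otherwise a vector of the dual killing these but not [e] is a
   rank-one element. *)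
Lemma psd_of_line m n (w : 'rV_m -> 'rV_n -> 'rV_d) u (e : 'rV_d) lam b :
  bilin w -> no_rank1 w -> e != 0 -> lam b = 1 ->
  (forall a, w u a = lam a *: e) -> psd_block_sum w.
Proof.
move=> bw nw e0 lb we; have [lr ll] := bw.
(* [c j] is the projection of a basis vector to the kernel of [lam] along [b], so the [z p] span all
   [w v c] with [lam c = 0]. *)
pose c (j : 'I_n) := 'e_j - lam 'e_j *: b.
pose z (p : 'I_m * 'I_n) := w 'e_p.1 (c p.2).
(* [lam] inherits linearity from [w u]: compare a coordinate where [e] is nonzero. *)
have lamE a a' k : lam (k *: a + a') = k * lam a + lam a'.
  case/rV0Pn: e0 => i ei; apply: (mulIf ei).
  move/rowP/(_ i): (lr u k a a'); rewrite !we !mxE => ->; ring.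
have lc j : lam (c j) = 0.
  have -> : c j = (- lam 'e_j) *: b + 'e_j by rewrite /c scaleNr addrC.
  by rewrite lamE lb; ring.
have [/sub_sumsmxP[k ek]|ne] := boolP (e <= \sum_p <<z p>>)%MS.
  have kz p : exists r, k p *m <<z p>>%MS == r *: z p.
    have /sub_rVP[r ->] : (k p *m <<z p>> <= z p)%MS; last by exists r.
    by rewrite (submx_trans (submxMl _ _)) // genmxE.
  have [r er] : exists r : 'I_m * 'I_n -> F, e = \sum_p r p *: z p.
    pose r p := xchoose (kz p); exists r.
    by rewrite [LHS]ek; apply: eq_bigr => p _; rewrite (eqP (xchooseP (kz p))).
  (* Since [w u b = e] and [w u (c p.2) = 0], each block determinant is the product of the forms [e]
     and [r p *: z p]; these add up to the square of [e]. *)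
  exists [seq (u, 'e_p.1, (b, r p *: c p.2)) | p <- index_enum _].
  have E x : \sum_(t <- [seq (u, 'e_p.1, (b, r p *: c p.2)) | p <- index_enum _])
     block_det w t x = pairing e x ^+ 2.
    rewrite expr2 {2}er pairing_suml mulr_sumr big_map; apply: eq_bigr => p _.
    rewrite /block_det /= we lb scale1r (linpZ (lr _)) pairingZl -/(z p).
    rewrite (linpZ (lr _)) (we (c p.2)) lc scale0r scaler0 pairing0l mul0r.
    by rewrite subr0.
  split=> [x|]; first by rewrite E sqr_ge0.
  by have [x ex] := pairing_neq0 e0; exists x; rewrite E sqrf_eq0.
move: ne; rewrite submxE => /rV0Pn[j ej].
pose Z := (\sum_p <<z p>>)%MS.
(* A column of the cokernel matrix kills every [z p]; the [j]-th one does not kill [e]. *)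
pose x := col j (cokermx Z).
have xe : pairing e x != 0 by rewrite pairing_col.
have xz p : pairing (z p) x = 0.
  have : (z p <= Z)%MS by rewrite (sumsmx_sup p) // genmxE.
  by rewrite submxE => /eqP zp; rewrite pairing_col zp mxE.
case/eqP: xe; rewrite (no_rank1_basis (x := x) (g := fun l => lam 'e_l)
  (f := fun i => pairing (w 'e_i b) x) bw nw) ?pairing0r // => i l.
have := xz (i, l); rewrite /z /c /= (linpB (lr _)) (linpZ (lr _)).
by rewrite pairingBl pairingZl => /eqP; rewrite subr_eq0 mulrC => /eqP.
Qed.

(** The image of [w u] is a line. Pick a spanning vector [e = w u b]; the coordinate along [e], read
    off by the pseudo-inverse, equals 1 at [b]. *)
Lemma psd_of_rank1 m n (w : 'rV_m -> 'rV_n -> 'rV_d) u :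
  bilin w -> no_rank1 w -> \rank (\matrix_i w u 'e_i) = 1%N ->
  psd_block_sum w.
Proof.
move=> bw nw; set T := \matrix_i _ => rT.
have TE : forall a, a *m T = w u a := linear_mulmxE (bw.1 u).
have /rowV0Pn[e /submxP[b be] e0] : T != 0 by rewrite -mxrank_eq0 rT.
have Te : (T <= e)%MS.
  have eT : (e <= T)%MS by rewrite be submxMl.
  by rewrite -(geq_leqif (mxrank_leqif_sup eT)) rT lt0n mxrank_eq0.
pose lam (a : 'rV_n) := (a *m T *m pinvmx e) 0 0.
have le a : w u a = lam a *: e.
  rewrite -TE -[LHS](@mulmxKpV _ _ _ _ _ e) ?(submx_trans (submxMl _ _)) //.
  by rewrite [a *m T *m _]mx11_scalar mul_scalar_mx.
apply: (psd_of_line (b := b) bw nw e0 _ le).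
have := le b; rewrite -TE -be => /eqP; rewrite -{1}[e]scale1r -subr_eq0 -scalerBl.
by rewrite scaler_eq0 (negPf e0) orbF subr_eq0 => /eqP.
Qed.

Lemma psd_of_zero m n (w : 'rV_m -> 'rV_n -> 'rV_d) u a b v :
  (d <= 3)%N -> bilin w -> no_rank1 w ->
  w u a = 0 -> w u b != 0 -> w v a != 0 -> psd_block_sum w.
Proof.
move=> d3 bw nw ua ub va.
set T := \matrix_i w u 'e_i; set S := \matrix_i w 'e_i a.
have TE : forall c, c *m T = w u c := linear_mulmxE (bw.1 u).
have SE : forall c, c *m S = w c a := linear_mulmxE (bw.2 a).
have [|] := boolP ((T :&: S)%MS == 0); last first.
  case/rowV0Pn=> l; rewrite sub_capmx => /andP[/submxP[b' lb] /submxP[v' lv]] l0.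
  (* [w u a = 0] removes the antidiagonal product, and both diagonal entries are [l]. *)
  have D x : block_det w (u, v', (b', a)) x = pairing l x ^+ 2.
    by rewrite /block_det /= ua pairing0l -TE -lb -SE -lv; ring.
  apply: (@psd_block_sum1 _ _ _ (u, v', (b', a))) => [x|].
    by rewrite D sqr_ge0.
  by have [x ex] := pairing_neq0 l0; exists x; rewrite D sqrf_eq0.
rewrite -mxrank_eq0 => /eqP TS.
have T0 : (0 < \rank T)%N.
  by rewrite lt0n mxrank_eq0; apply: contra ub => /eqP T0; rewrite -TE T0 mulmx0.
have S0 : (0 < \rank S)%N.
  by rewrite lt0n mxrank_eq0; apply: contra va => /eqP S0; rewrite -SE S0 mulmx0.
have rTS : (\rank T + \rank S <= 3)%N.
  by rewrite -mxrank_sum_cap TS addn0 (leq_trans (rank_leq_col _)).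
have [rT|rT] := eqVneq (\rank T) 1%N; first exact: psd_of_rank1 bw nw rT.
have rS : \rank S = 1%N by lia.
apply: psd_block_sum_swap.
exact: psd_of_rank1 (bilin_swap bw) (no_rank1_swap nw) rS.
Qed.

End BilinearMaps.

(** * Zeros of nondegenerate bilinear maps *)

Definition right_nondegenerate (F : rcfType) (d m n : nat)
    (w : 'rV[F]_m -> 'rV[F]_n -> 'rV[F]_d) :=
  forall a, (forall u, w u a = 0) -> a = 0.

(** With at most one column every matrix has rank at most 1, so every [x] would vanish,
    contradicting [0 < d]. *)
Lemma no_rank1_dim_gt1 (F : rcfType) (d m n : nat)
    (w : 'rV[F]_m -> 'rV[F]_n -> 'rV[F]_d) :
  (0 < d)%N -> bilin w -> no_rank1 w -> (1 < n)%N.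
Proof.
move=> d0 bw nw; rewrite ltnNge; apply/negP => n1.
have: const_mx 1 = 0 :> 'cV[F]_d.
  (* The sum over [j] has at most one term, and it also makes sense when [n = 0]. *)
  apply: (no_rank1_basis (f := fun i => \sum_j pairing (w 'e_i 'e_j) (const_mx 1))
    (g := fun=> 1) bw nw) => i j.
  rewrite mulr1 (bigD1 j) //= big1 ?addr0 // => k /eqP kj; case: kj.
  by apply: val_inj => /=; have := ltn_ord k; have := ltn_ord j; lia.
by move/matrixP/(_ (Ordinal d0) 0); rewrite !mxE => /eqP; rewrite oner_eq0.
Qed.

Lemma exists_zero_pair (F : rcfType) (d m n : nat)
    (w : 'rV[F]_m -> 'rV[F]_n -> 'rV[F]_d) :
  (d <= 3)%N -> (1 < m)%N -> (2 < n)%N -> bilin w ->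
  exists u a, [/\ u != 0, a != 0 & w u a = 0].
Proof.
move=> d3 m2 n3 bw.
pose i0 := Ordinal (ltnW m2); pose i1 := Ordinal m2.
pose T u := \matrix_i w u 'e_i.
have TE u a : a *m T u = w u a := linear_mulmxE (bw.1 u) a.
(* [G] embeds a three-dimensional space as the first three coordinates. *)
pose G : 'M[F]_(3, n) := pid_mx 3.
have fG : row_free G by rewrite /row_free rank_pid_mx.
have e_neq0 (i : 'I_m) : 'e_i != 0 :> 'rV[F]_m.
  by apply/rV0Pn; exists i; rewrite mxE !eqxx oner_eq0.
have ker u (k : 'rV_3) : u != 0 -> k != 0 -> k *m (G *m T u) = 0 ->
    exists u a, [/\ u != 0, a != 0 & w u a = 0].
  move=> u0 k0 kG; exists u, (k *m G); split=> //.
    by rewrite mulmx_free_eq0.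
  by rewrite -TE -mulmxA.
move: d3; rewrite leq_eqVlt => /orP[/eqP d3|d3]; last first.
  have : kermx (G *m T 'e_i0) != 0.
    rewrite kermx_eq0 /row_free; apply/eqP => r3.
    by have := rank_leq_col (G *m T 'e_i0); rewrite r3 leqNgt d3.
  case/rowV0Pn=> k /sub_kermxP kG k0.
  exact: ker (e_neq0 _) k0 kG.
subst d; pose A := G *m T 'e_i0; pose B := G *m T 'e_i1.
have [/eqP/det0P[k k0 kB]|B0] := eqVneq (\det B) 0.
  exact: ker (e_neq0 _) k0 kB.
have uB : B \in unitmx by rewrite unitmxE unitfE.
(* The characteristic polynomial has degree 3, hence a root [t] in the real closed field [F], and
   [A - t B] is singular. *)
have [t] := @polyrcf.odd_poly_root _ (char_poly (A *m invmx B))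
  ltac:(by rewrite size_char_poly).
rewrite -eigenvalue_root_char => /eigenvalueP[k kt k0].
have kAB : k *m A = t *: (k *m B).
  by rewrite -[A](mulmxKV uB) mulmxA kt scalemxAl.
apply: (ker ('e_i0 - t *: 'e_i1) k _ k0).
  apply/rV0Pn; exists i0; rewrite !mxE !eqxx /=.
  by rewrite mulr0 subr0 oner_eq0.
have -> : T ('e_i0 - t *: 'e_i1) = T 'e_i0 - t *: T 'e_i1.
  by apply/matrixP => i j; rewrite !mxE (bilinBl bw) (bilinZl bw) !mxE.
by rewrite mulmxBr -scalemxAr mulmxBr -scalemxAr kAB subrr.
Qed.

(** Nondegeneracy on each side turns the nonzero [u] and [a] of a zero pair into nonzero maps, as
    [psd_of_zero] requires. *)
Lemma psd_of_dim_gt2 (F : rcfType) (d m n : nat)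
    (w : 'rV[F]_m -> 'rV[F]_n -> 'rV[F]_d) :
  (d <= 3)%N -> (1 < m)%N -> (2 < n)%N -> bilin w -> no_rank1 w ->
  right_nondegenerate w -> right_nondegenerate (fun a u => w u a) ->
  psd_block_sum w.
Proof.
move=> d3 m2 n3 bw nw ndr ndl.
have [u [a [u0 a0 ua]]] := exists_zero_pair d3 m2 n3 bw.
have [T T0] : exists T : 'M_(n, d), T = \matrix_i w u 'e_i by eexists.
have [S S0] : exists S : 'M_(m, d), S = \matrix_i w 'e_i a by eexists.
have TE c : c *m T = w u c by rewrite T0 (linear_mulmxE (bw.1 u)).
have SE c : c *m S = w c a by rewrite S0 (linear_mulmxE (bw.2 a)).
have /rowV0Pn[_ /submxP[b ->] ub] : T != 0.
  by apply: contra u0 => /eqP Tz; apply/eqP/ndl => b; rewrite -TE Tz mulmx0.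
have /rowV0Pn[_ /submxP[v ->] va] : S != 0.
  by apply: contra a0 => /eqP Sz; apply/eqP/ndr => v; rewrite -SE Sz mulmx0.
rewrite TE in ub; rewrite SE in va.
exact: psd_of_zero d3 bw nw ua ub va.
Qed.

(** * The case of 2x2 matrices *)

(** The discriminant is positive because [a] and [c] have opposite signs. *)
Lemma quadratic_root (F : rcfType) (a b c : F) : a < 0 -> 0 < c ->
  exists t, c + t * b + t ^+ 2 * a = 0.
Proof.
move=> a0 c0; pose r := Num.sqrt (b ^+ 2 - 4 * a * c).
have rE : r ^+ 2 = b ^+ 2 - 4 * a * c by rewrite sqr_sqrtr; nra.
exists ((r - b) / (2 * a)).
have -> : c + (r - b) / (2 * a) * b + ((r - b) / (2 * a)) ^+ 2 * a
   = (r ^+ 2 - b ^+ 2 + 4 * a * c) / (4 * a) by field; lra.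
by rewrite rE; field; lra.
Qed.

Lemma psd_of_dim2 (F : rcfType) (d : nat)
    (w : 'rV[F]_2 -> 'rV[F]_2 -> 'rV[F]_d) :
  (0 < d)%N -> bilin w -> no_rank1 w -> psd_block_sum w.
Proof.
move=> d0 bw nw.
pose P (i j : 'I_2) x := pairing (w 'e_i 'e_j) x.
pose D x := P 0 0 x * P 1 1 x - P 0 1 x * P 1 0 x.
have I2 (i : 'I_2) : i = 0 \/ i = 1.
  by case: i => [[|[|//]] hi]; [left|right]; apply: val_inj.
(* A vanishing determinant yields a factorisation: through the pivot [P 0 0 x] if it is nonzero,
   otherwise through a zero first row or first column. *)
have D0 x : D x = 0 -> x = 0.
  move/eqP; rewrite subr_eq0 => /eqP Dx.
  have [P0|P0] := eqVneq (P 0 0 x) 0; last first.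
    apply: (no_rank1_basis (f := fun i => P i 0 x)
      (g := fun j => P 0 j x / P 0 0 x) bw nw) => i j.
    rewrite -/(P i j x); apply: (mulIf P0); rewrite -mulrA divfK //.
    by case: (I2 i) (I2 j) => -> [] ->; first [ring | rewrite mulrC Dx; ring].
  move: Dx; rewrite P0 mul0r => /esym/eqP; rewrite mulf_eq0.
  case/orP=> /eqP P1.
    apply: (no_rank1_basis (f := fun i => (i == 1)%:R)
      (g := fun j => P 1 j x) bw nw) => i j; rewrite -/(P i j x).
    by case: (I2 i) (I2 j) => -> [] ->; rewrite ?P0 ?P1 /= ?mul0r ?mul1r.
  apply: (no_rank1_basis (f := fun i => P i 1 x)
    (g := fun j => (j == 1)%:R) bw nw) => i j; rewrite -/(P i j x).
  by case: (I2 i) (I2 j) => -> [] ->; rewrite ?P0 ?P1 /= ?mulr0 ?mulr1.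
(* A sign change gives a zero of [D] at some [x + t y]. Then [x = - t y], and [D x = t^2 D y] has
   the wrong sign. *)
have Dlt x y : 0 < D x -> D y < 0 -> False.
  move=> Dx Dy.
  (* The coefficient of [t] in [D (x + t y)]. *)
  pose b := P 0 0 x * P 1 1 y + P 0 0 y * P 1 1 x
            - P 0 1 x * P 1 0 y - P 0 1 y * P 1 0 x.
  have [t tE] := quadratic_root b Dy Dx.
  have /D0/eqP : D (x + t *: y) = 0.
    by rewrite -tE /b /D /P !pairingDr !pairingZr; ring.
  rewrite addr_eq0 => /eqP xE; move: Dx.
  have -> : D x = t ^+ 2 * D y.
    by rewrite xE -scaleNr /D /P !pairingZr; ring.
  by rewrite ltNge mulr_ge0_le0 ?sqr_ge0 // ltW.
have [x x0] : exists x : 'cV[F]_d, x != 0.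
  exists (const_mx 1); apply/eqP => /matrixP/(_ (Ordinal d0) 0).
  by rewrite !mxE => /eqP; rewrite oner_eq0.
have Dx : D x != 0 by apply: contra x0 => /eqP/D0 ->.
have [Dx0|Dx0] := ltP 0 (D x).
  apply: (@psd_block_sum1 _ _ _ _ _ ('e_0, 'e_1, ('e_0, 'e_1))); last by exists x.
  by move=> y; rewrite leNgt; apply/negP; apply: Dlt Dx0.
(* Swapping the two columns makes [- D] a block determinant as well. *)
have swapE y : block_det w ('e_0, 'e_1, ('e_1, 'e_0)) y = - D y.
  by rewrite /block_det /D /P /=; ring.
apply: (@psd_block_sum1 _ _ _ _ _ ('e_0, 'e_1, ('e_1, 'e_0))).
  move=> y; rewrite swapE oppr_ge0 leNgt; apply/negP => Dy.
  by apply: (Dlt y x Dy); rewrite lt_neqAle Dx.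
by exists x; rewrite swapE oppr_eq0.
Qed.

(** * Reduction to nondegenerate maps *)

(** The quotient by the right kernel [N] is realised on a complement: the rows of [B] are a basis of
    it, and [C] gives coordinates in that basis, modulo [N]. *)
Lemma right_nondegenerate_reduction (F : rcfType) (d m n : nat)
    (w : 'rV[F]_m -> 'rV[F]_n -> 'rV[F]_d) : bilin w ->
  exists n' (B : 'M_(n', n)) (C : 'M_(n, n')),
    (forall u a, w u a = w u (a *m C *m B)) /\
    right_nondegenerate (fun u a => w u (a *m B)).
Proof.
move=> bw; pose T u := \matrix_i w u 'e_i.
have TE u a : a *m T u = w u a := linear_mulmxE (bw.1 u) a.
pose N := (\bigcap_i kermx (T 'e_i))%MS.
have NP (a : 'rV_n) : (a <= N)%MS -> forall u, w u a = 0.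
  move/sub_bigcapmxP => aN u; rewrite -(linear_mulmxE (bw.2 a)) mulmx_sum_row.
  rewrite big1 // => i _; rewrite rowK -TE.
  by have /sub_kermxP -> := aN i isT; rewrite scaler0.
pose B := row_base N^C%MS.
have /sub_addsmxP[[D C] /= DC] : (1%:M <= N + B)%MS.
  rewrite (adds_eqmx (eqmx_refl _) (eq_row_base _)).
  exact: submx_full (addsmx_compl_full N).
exists _, B, C; split=> [u a|a wa].
  rewrite -[in LHS](mulmx1 a) DC mulmxDr (linpD (bw.1 u)) mulmxA NP ?add0r.
    by rewrite mulmxA.
  exact: submxMl.
have aN : (a *m B <= N)%MS.
  by apply/sub_bigcapmxP => i _; apply/sub_kermxP; rewrite TE.
have aC : (a *m B <= N^C)%MS.
  by apply: submx_trans (submxMl _ _) _; rewrite eq_row_base.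
have : (a *m B <= N :&: N^C)%MS by rewrite sub_capmx aN.
by rewrite capmx_compl submx0 mulmx_free_eq0 ?row_base_free // => /eqP.
Qed.

Lemma bilin_pullback (F : rcfType) (d m n n' : nat)
    (w : 'rV[F]_m -> 'rV[F]_n -> 'rV[F]_d) (B : 'M_(n', n)) :
  bilin w -> bilin (fun u a => w u (a *m B)).
Proof.
move=> [lr ll]; split=> [u k a b|a k u v]; last exact: ll.
by rewrite mulmxDl -scalemxAl lr.
Qed.

(** A factorisation of the restricted map becomes one of [w] when [g] is composed with [C]. *)
Lemma no_rank1_pullback (F : rcfType) (d m n n' : nat)
    (w : 'rV[F]_m -> 'rV[F]_n -> 'rV[F]_d) (B : 'M_(n', n)) C :
  (forall u a, w u a = w u (a *m C *m B)) -> no_rank1 w ->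
  no_rank1 (fun u a => w u (a *m B)).
Proof.
move=> wC nw x f g fg; apply: (nw x f (fun a => g (a *m C))) => u a.
by rewrite wC fg.
Qed.

Lemma psd_block_sum_pullback (F : rcfType) (d m n n' : nat)
    (w : 'rV[F]_m -> 'rV[F]_n -> 'rV[F]_d) (B : 'M_(n', n)) :
  psd_block_sum (fun u a => w u (a *m B)) -> psd_block_sum w.
Proof.
case=> s [s0 [x sx]]; exists [seq (t.1, (t.2.1 *m B, t.2.2 *m B)) | t <- s].
by split=> [z|]; [|exists x]; rewrite big_map; [apply: s0|apply: sx].
Qed.

Lemma psd_of_nondegenerate (F : rcfType) (d m n : nat)
    (w : 'rV[F]_m -> 'rV[F]_n -> 'rV[F]_d) :
  (0 < d <= 3)%N -> bilin w -> no_rank1 w ->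
  right_nondegenerate w -> right_nondegenerate (fun a u => w u a) ->
  psd_block_sum w.
Proof.
move=> /andP[d0 d3] bw nw ndr ndl.
have [bw' nw'] := (bilin_swap bw, no_rank1_swap nw).
have n1 := no_rank1_dim_gt1 d0 bw nw; have m1 := no_rank1_dim_gt1 d0 bw' nw'.
have [n3|n2] := ltnP 2 n; first exact: psd_of_dim_gt2 bw nw ndr ndl.
have [m3|m2] := ltnP 2 m.
  by apply: psd_block_sum_swap; apply: psd_of_dim_gt2 bw' nw' ndl ndr.
have {n1 n2} n2 : n = 2%N by apply/eqP; rewrite eqn_leq n2.
have {m1 m2} m2 : m = 2%N by apply/eqP; rewrite eqn_leq m2.
by subst m n; apply: psd_of_dim2.
Qed.

Lemma psd_block_sum_exists (F : rcfType) (d m n : nat)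
    (w : 'rV[F]_m -> 'rV[F]_n -> 'rV[F]_d) :
  (0 < d <= 3)%N -> bilin w -> no_rank1 w -> psd_block_sum w.
Proof.
move=> d03 bw nw.
have [n' [B [C [wC ndr]]]] := right_nondegenerate_reduction bw.
apply: (psd_block_sum_pullback (B := B)).
move: (bilin_pullback B bw) (no_rank1_pullback wC nw) ndr.
set w1 := (fun u a => w u (a *m B)) => bw1 nw1 ndr.
have [m' [B' [C' [wC' ndl]]]] := right_nondegenerate_reduction (bilin_swap bw1).
apply: psd_block_sum_swap; apply: (psd_block_sum_pullback (B := B')).
apply: psd_of_nondegenerate ndl _ => //.
- exact: bilin_pullback (bilin_swap bw1).
- exact: no_rank1_pullback wC' (no_rank1_swap nw1).
(* Reducing the left factor keeps right nondegeneracy: by [wC'], the values of [w1] are all attained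
   on the span of [B']. *)
by move=> a wa; apply: ndr => u; rewrite wC' wa.
Qed.

(** * Expansion of block determinants into minors *)

(** The diagonal terms vanish, and the swap folds the pairs below the diagonal onto those above,
    with a sign. *)
Lemma sum_antisymmetric (R : comPzRingType) (n : nat) (c M : 'I_n -> 'I_n -> R) :
  (forall i, M i i = 0) -> (forall i j, M j i = - M i j) ->
  \sum_i \sum_j c i j * M i j
  = \sum_(p : 'I_n * 'I_n | (p.1 < p.2)%N)
      (c p.1 p.2 - c p.2 p.1) * M p.1 p.2.
Proof.
move=> Mii Mji; have swapK : involutive (fun p : 'I_n * 'I_n => (p.2, p.1)).
  by case.
rewrite pair_bigA /= (bigID (fun p : 'I_n * 'I_n => (p.1 < p.2)%N)) /=.
rewrite [X in _ + X](bigID (fun p : 'I_n * 'I_n => p.1 == p.2)) /=.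
rewrite [X in _ + (X + _)]big1 ?add0r; last first.
  by case=> i j /= /andP[_ /eqP ->]; rewrite Mii mulr0.
rewrite [X in _ + X](reindex_inj (inv_inj swapK)) /=.
rewrite [X in _ + X](eq_bigl (fun p : 'I_n * 'I_n => (p.1 < p.2)%N)).
  by rewrite -big_split /=; apply: eq_bigr => p _; rewrite Mji; ring.
by case=> i j /=; rewrite -leqNgt ltn_neqAle andbC eq_sym.
Qed.

Lemma mulmx_row_col (R : comPzRingType) (m n : nat) (X : 'M[R]_(m, n))
    (u : 'rV_m) (a : 'rV_n) :
  (u *m X *m a^T) 0 0 = \sum_i \sum_j u 0 i * a 0 j * X i j.
Proof.
rewrite mxE exchange_big; apply: eq_bigr => j _; rewrite !mxE mulr_suml.
by apply: eq_bigr => i _; ring.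
Qed.

(** This is the Cauchy-Binet formula for the product of the rows [u], [v], the matrix [X] and the
    columns [a^T], [b^T]. It is proved by applying antisymmetry to the column indices, then to the
    row indices. *)
Lemma block_det_minors (R : comPzRingType) (m n : nat) (X : 'M[R]_(m, n))
    (u v : 'rV_m) (a b : 'rV_n) :
  (u *m X *m a^T) 0 0 * (v *m X *m b^T) 0 0
  - (u *m X *m b^T) 0 0 * (v *m X *m a^T) 0 0
  = \sum_(k : minor_idx m n)
      (u 0 (val k).1.1 * v 0 (val k).1.2 - u 0 (val k).1.2 * v 0 (val k).1.1)
      * (a 0 (val k).2.1 * b 0 (val k).2.2 - a 0 (val k).2.2 * b 0 (val k).2.1)
      * minor2 k X.
Proof.
(* The minor for arbitrary indices, antisymmetric in the rows and in the columns. *)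
pose M i i' j j' := X i j * X i' j' - X i j' * X i' j.
pose c i i' := u 0 i * v 0 i'; pose e j j' := a 0 j * b 0 j'.
have prodE (y z : 'rV[R]_n) : (u *m X *m y^T) 0 0 * (v *m X *m z^T) 0 0 =
    \sum_i \sum_i' c i i' *
      \sum_j \sum_j' y 0 j * z 0 j' * (X i j * X i' j').
  rewrite !mulmx_row_col mulr_suml; apply: eq_bigr => i _.
  rewrite mulr_sumr; apply: eq_bigr => i' _; rewrite mulr_suml mulr_sumr.
  apply: eq_bigr => j _; rewrite !mulr_sumr; apply: eq_bigr => j' _.
  by rewrite /c; ring.
have -> : (u *m X *m a^T) 0 0 * (v *m X *m b^T) 0 0
  - (u *m X *m b^T) 0 0 * (v *m X *m a^T) 0 0
  = \sum_i \sum_i' c i i' * \sum_j \sum_j' e j j' * M i i' j j'.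
  rewrite !prodE -sumrB; apply: eq_bigr => i _.
  rewrite -sumrB; apply: eq_bigr => i' _; rewrite -mulrBr; congr (_ * _).
  rewrite [X in _ - X]exchange_big -sumrB; apply: eq_bigr => j _.
  by rewrite -sumrB; apply: eq_bigr => j' _; rewrite /e /M; ring.
pose N i i' := \sum_(q : 'I_n * 'I_n | (q.1 < q.2)%N)
  (e q.1 q.2 - e q.2 q.1) * M i i' q.1 q.2.
have NE i i' : \sum_j \sum_j' e j j' * M i i' j j' = N i i'.
  by apply: sum_antisymmetric => [j|j j']; rewrite /M; ring.
under eq_bigr do under eq_bigr do rewrite NE.
rewrite sum_antisymmetric => [|i|i i']; last 2 first.
- by apply: big1 => q _; rewrite /M; ring.
- by rewrite -sumrN; apply: eq_bigr => q _; rewrite /M; ring.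
under eq_bigr do rewrite mulr_sumr.
rewrite pair_big /=.
(* Pairs of increasing index pairs are exactly the elements of the subtype [minor_idx]. *)
rewrite (reindex_omap (fun k : minor_idx m n => val k) insub) /=; last first.
  by move=> p Pp; rewrite insubT.
apply: eq_big => [k|k _]; last first.
  by rewrite mulrA /minor2 /c /e /M; case: k => [[[i1 i2] [j1 j2]] ?] /=; ring.
by rewrite valK eqxx (valP k).
Qed.

(** * From the subspace to the bilinear map and back *)

Theorem theorem7 (R : realType) (m n d : nat) (K : {vspace 'M[R]_(m, n)}) :
  (1 <= d <= 3)%N ->
  \dim K = d ->
  ~ has_rank1_connections K ->
  exists beta : {ffun minor_idx m n -> R},
    beta != 0 /\
    (forall X, X \in K -> 0 <= \sum_k beta k * minor2 k X) /\
    (exists X, X \in K /\ \sum_k beta k * minor2 k X != 0).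
Proof.
move=> d13 dK nr; subst d.
pose Xi := vbasis K; pose X (x : 'cV[R]_(\dim K)) := \sum_i x i 0 *: Xi`_i.
have XK x : X x \in K.
  apply: memv_suml => i _; apply: memvZ; apply: vbasis_mem.
  by rewrite mem_nth ?size_tuple.
pose w (u : 'rV_m) (a : 'rV_n) :=
  \row_(i < \dim K) (u *m Xi`_i *m a^T) 0 0.
have wE u a x : pairing (w u a) x = (u *m X x *m a^T) 0 0.
  rewrite /pairing mxE /X mulmx_sumr mulmx_suml summxE.
  apply: eq_bigr => i _; rewrite [w u a 0 i]mxE -scalemxAr -scalemxAl.
  by rewrite [RHS]mxE mulrC.
have wiE u a i : w u a 0 i = (u *m Xi`_i *m a^T) 0 0 by rewrite mxE.
have bw : bilin w.
  split=> [u k a b|a k u v]; apply/rowP => i.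
    rewrite [RHS]mxE [X in _ = X + _]mxE !wiE [(_ + _)^T]linearP mulmxDr.
    by rewrite -scalemxAr mxE [X in X + _ = _]mxE.
  rewrite [RHS]mxE [X in _ = X + _]mxE !wiE !mulmxDl -!scalemxAl.
  by rewrite mxE [X in X + _ = _]mxE.
have nw : no_rank1 w.
  move=> x f g fg.
  (* Evaluating on basis vectors writes [X x] as a column times a row; if nonzero, it would be
     rank-one connected to 0. *)
  have Xfg : X x = (\col_i f 'e_i) *m (\row_j g 'e_j).
    apply/matrixP => i j; rewrite mxE big_ord1 !mxE -fg wE.
    by rewrite -rowE trmx_delta -colE !mxE.
  have X0 : X x = 0.
    apply/eqP/negPn/negP => X0; case: nr; exists (X x), 0.
    split; first exact: XK.
    split; first exact: mem0v.
    split=> //; rewrite subr0; apply/eqP; rewrite eqn_leq lt0n mxrank_eq0 X0 andbT.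
    by rewrite Xfg (leq_trans (mxrankM_maxl _ _)) ?rank_leq_col.
  have /freeP fK := basis_free (vbasisP K).
  by apply/colP => i; rewrite mxE; apply: fK X0 i.
have [s [s0 [x sx]]] := psd_block_sum_exists d13 bw nw.
(* [beta] collects the Cauchy-Binet coefficients of all the blocks in [s]. *)
pose beta : {ffun minor_idx m n -> R} := [ffun k => \sum_(t <- s)
  (t.1.1 0 (val k).1.1 * t.1.2 0 (val k).1.2
   - t.1.1 0 (val k).1.2 * t.1.2 0 (val k).1.1)
  * (t.2.1 0 (val k).2.1 * t.2.2 0 (val k).2.2
     - t.2.1 0 (val k).2.2 * t.2.2 0 (val k).2.1)].
have betaE y : \sum_k beta k * minor2 k (X y) = \sum_(t <- s) block_det w t y.
  under eq_bigr do rewrite ffunE mulr_suml.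
  rewrite exchange_big; apply: eq_bigr => t _.
  by rewrite -block_det_minors -!wE.
exists beta; split; last split.
- apply: contra sx => /eqP b0; rewrite -betaE b0 big1 // => k _.
  by rewrite ffunE mul0r.
- move=> Y YK; pose y := \col_i coord Xi i Y.
  have -> : Y = X y.
    rewrite [LHS](coord_vbasis YK).
    by apply: eq_bigr => i _; rewrite mxE.
  by rewrite betaE s0.
by exists (X x); rewrite XK betaE.
Qed.
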